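(* Let $n\geq 3$ be an integer and let $p$ be an odd prime number. Let $F$ be a $p$-rigid field which contains a primitive $p$-th root of unity. Then for any $\alpha_1,\ldots,\alpha_n\in H^1(G_F,\mathbb{F}_p)$, the $n$-fold Massey product $\langle\alpha_1,\ldots,\alpha_n\rangle$ contains $0$ whenever it is defined.
   Context: For $a\in F^\times$, $\chi_a\in H^1(G_F,\mathbb{F}_p)$ is the Kummer character of $a$. An element $a\in F^\times\setminus(F^\times)^p$ is $p$-rigid if for $b\in F^\times$, $\chi_a\cup\chi_b=0$ in $H^2(G_F,\mathbb{F}_p)$ implies $b\in a^i(F^\times)^p$ for some $i\geq0$; $F$ is $p$-rigid if every element of $F^\times\setminus(F^\times)^p$ is $p$-rigid. Massey products: for a profinite group $G$ with trivial module $\mathbb{F}_p$ and inhomogeneous continuous cochain complex $\mathcal{C}^\bullet(G,\mathbb{F}_p)$ (differential $\delta$, cup product $\cup$), a defining system for $\langle\alpha_1,\ldots,\alpha_n\rangle$ ($\alpha_i\in H^1(G,\mathbb{F}_p)$) is a family $(a_{ij})$, $1\leq i<j\leq n+1$, $(i,j)\neq(1,n+1)$, of $1$-cochains with $a_{i,i+1}$ representing $\alpha_i$ and $\delta a_{ij}=\sum_{l=i+1}^{j-1}a_{il}\cup a_{lj}$ for $i+1<j$; its value is the class of the $2$-cocycle $\sum_{k=2}^n a_{1k}\cup a_{k,n+1}$. The Massey product is the set of all such values, and is defined if some defining system exists. *)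

(* Defs.v *)
From HB Require Import structures.
From mathcomp Require Import all_boot all_order all_algebra all_field.
Set Implicit Arguments. Unset Strict Implicit. Unset Printing Implicit Defensive.
Import GRing.Theory.
Local Open Scope ring_scope.

Section Galois.
Variables (F L : fieldType) (iota : {rmorphism F -> L}).

Definition is_sep_closure : Prop :=
  (forall x : L, exists q : {poly F},
      q != 0 /\ separable_poly q /\ root (map_poly iota q) x) /\
  (forall q : {poly L}, (1 < size q)%N -> separable_poly q -> exists x, root q x).

Definition inG (s : L -> L) : Prop :=
  [/\ forall x y, s (x + y) = s x + s y,
      forall x y, s (x * y) = s x * s y,
      s 1 = 1,
      bijective s &
      forall c, s (iota c) = iota c].

Variable p : nat.

(* Inhomogeneous 1-cochains and 2-cochains of G_F with values in F_p
   (only their values on G_F matter). *)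
Definition cochain1 := (L -> L) -> 'F_p.
Definition cochain2 := (L -> L) -> (L -> L) -> 'F_p.

(* Continuity for the Krull topology (F_p discrete): locally constant,
   a basic neighbourhood of s being {t | t = s on a finite set S}. *)
Definition continuous1 (c : cochain1) : Prop :=
  forall s, inG s -> exists S : seq L, forall t, inG t ->
    (forall x, x \in S -> t x = s x) -> c t = c s.

Definition cobound1 (c : cochain1) : cochain2 :=
  fun s t => c t - c (s \o t) + c s.

Definition cup11 (a b : cochain1) : cochain2 := fun s t => a s * b t.

Definition H1elt (c : cochain1) : Prop :=
  continuous1 c /\ forall s t, inG s -> inG t -> cobound1 c s t = 0.

Definition H2zero (z : cochain2) : Prop :=
  exists c : cochain1, continuous1 c /\
    forall s t, inG s -> inG t -> z s t = cobound1 c s t.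

Definition kummer (zeta a : F) (chi : cochain1) : Prop :=
  exists alpha : L, alpha ^+ p = iota a /\
    forall s, inG s -> s alpha = (iota zeta) ^+ (nat_of_ord (chi s)) * alpha.

Definition not_pth_power (a : F) : Prop := a != 0 /\ ~ (exists c, a = c ^+ p).

Definition p_rigid_elt (zeta a : F) : Prop :=
  not_pth_power a /\
  forall b : F, b != 0 -> forall ca cb : cochain1,
    kummer zeta a ca -> kummer zeta b cb -> H2zero (cup11 ca cb) ->
    exists (i : nat) (c : F), c != 0 /\ b = a ^+ i * c ^+ p.

Definition p_rigid (zeta : F) : Prop :=
  forall a : F, not_pth_power a -> p_rigid_elt zeta a.

Definition defining_system (n : nat) (alpha : nat -> cochain1)
    (a : nat -> nat -> cochain1) : Prop :=
  [/\ (forall i j, (1 <= i)%N -> (i < j <= n.+1)%N -> (i, j) <> (1%N, n.+1) ->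
         continuous1 (a i j)),
      (forall i, (1 <= i <= n)%N -> forall s, inG s -> a i i.+1 s = alpha i s) &
      (forall i j, (1 <= i)%N -> (i.+1 < j <= n.+1)%N -> (i, j) <> (1%N, n.+1) ->
         forall s t, inG s -> inG t ->
           cobound1 (a i j) s t = \sum_(i.+1 <= l < j) a i l s * a l j t)].

Definition massey_value (n : nat) (a : nat -> nat -> cochain1) : cochain2 :=
  fun s t => \sum_(2 <= k < n.+1) a 1%N k s * a k n.+1 t.

Definition massey_defined n alpha : Prop :=
  exists a, defining_system n alpha a.

Definition massey_contains0 n alpha : Prop :=
  exists a, defining_system n alpha a /\ H2zero (massey_value n a).

End Galois.

(* Main.v *)
Require Import Defs.
From HB Require Import structures.
From mathcomp Require Import all_boot all_order all_algebra all_field.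
From mathcomp Require Import zify ring.
From mathcomp Require Import boolp classical_sets.
Set Implicit Arguments. Unset Strict Implicit. Unset Printing Implicit Defensive.
Import GRing.Theory.
Local Open Scope classical_set_scope.
Local Open Scope ring_scope.

(* If a Massey product is defined, then consecutive cup products vanish, so by
   rigidity consecutive nonzero classes are proportional.  After rescaling, and
   splitting at the zero classes into diagonal blocks, it suffices to find, for
   every character chi, a continuous homomorphism from the Galois group G to
   the unipotent matrices over F_p with all superdiagonal entries equal to chi.
   This needs no rigidity.  Let chi be the Kummer character of a: the action of
   G on the p^N-th roots of a and of unity is a homomorphism from G to the
   affine maps x |-> t x + b of Z/p^N with t = 1 mod p and b mod p = chi.
   Affine maps act on the group algebra F_p[Z/p^N] = F_p[X]/(X^(p^N)) by
   f(X) |-> (1+X)^b f((1+X)^t - 1), and X^k is sent to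
   X^k + b X^(k+1) + O(X^(k+2)), because (1+X)^t - 1 = X + O(X^3) for p odd.
   Kummer theory for G rests on the extension of F-embeddings to the separable
   closure, by Zorn's lemma on the graphs of partial embeddings. *)

(** * Extension of embeddings and the fixed field *)

Section ConjugateRoots.
Variables (K L : fieldType).

Lemma minimal_poly_exists (i : {rmorphism K -> L}) (q : {poly K}) (z : L) :
  q != 0 -> root (map_poly i q) z ->
  exists m, irreducible_poly m /\
    forall P, root (map_poly i P) z = (m %| P).
Proof.
move=> q0 qz.
pose S n := `[< exists m, [/\ m != 0, root (map_poly i m) z & size m = n] >].
have exS : exists n, S n by exists (size q); apply/asboolP; exists q.
case: (ex_minnP exS) => n /asboolP[m [m0 mz <-]] minm.
have mP P : root (map_poly i P) z = (m %| P).
  apply/idP/idP => [Pz|/dvdpP[r ->]]; last first.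
    by rewrite rmorphM /= rootM mz orbT.
  rewrite /dvdp; apply: contraT => r0.
  have : S (size (P %% m)).
    apply/asboolP; exists (P %% m); split=> //.
    move: Pz; rewrite {1}(divp_eq P m) rmorphD rmorphM /= /root hornerD hornerM.
    by rewrite (eqP mz) mulr0 add0r.
  by move/minm; rewrite leqNgt ltn_modp m0.
exists m; split=> //; split.
  have := root_size_gt1 _ mz; rewrite map_poly_eq0 size_map_poly; exact.
move=> r nr rm; case/dvdpP: (rm) => s ms.
have : root (map_poly i (s * r)) z by rewrite -ms.
rewrite rmorphM /= rootM !mP /eqp rm /= => /orP[ms'|//].
have s0 : s != 0 by apply: contraNneq m0 => s0; rewrite ms s0 mul0r.
have r0 : r != 0 by apply: contraNneq m0 => r0; rewrite ms r0 mulr0.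
have := dvdp_leq s0 ms'; rewrite ms size_mul //.
have : (0 < size s)%N by rewrite size_poly_gt0.
have : (0 < size r)%N by rewrite size_poly_gt0.
case: (size r) nr => [|[|k]] //; case: (size s) => // l _ _ _.
by rewrite !addnS /= ltnNge leq_addr.
Qed.

Lemma root_irreducible (f : {rmorphism K -> L}) (m : {poly K}) (w : L) :
  irreducible_poly m -> root (map_poly f m) w ->
  forall P, root (map_poly f P) w = (m %| P).
Proof.
move=> irm mw P; apply/idP/idP => [Pw|/dvdpP[r ->]]; last first.
  by rewrite rmorphM /= rootM mw orbT.
apply: contraT; rewrite -irreducible_poly_coprime // -(coprimep_map f) => cop.
by have := coprimep_root cop mw; rewrite (eqP Pw) eqxx.
Qed.

(** The minimal polynomial of [z] divides [q], so it is separable and its image under [f] has a root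
    [w]. Being irreducible, it decides vanishing at [z] and at [w] alike. *)
Lemma conjugate_root_exists (i f : {rmorphism K -> L}) (q : {poly K}) (z : L) :
  (forall r : {poly L}, (1 < size r)%N -> separable_poly r ->
     exists x, root r x) ->
  q != 0 -> separable_poly q -> root (map_poly i q) z ->
  exists w, forall P, root (map_poly i P) z = root (map_poly f P) w.
Proof.
move=> clL q0 sepq qz; have [m [irm mP]] := minimal_poly_exists q0 qz.
have sepm : separable_poly m by apply: dvdp_separable sepq; rewrite -mP.
have [||w mw] := clL (map_poly f m).
- by rewrite size_map_poly; case: irm.
- by rewrite separable_map.
by exists w => P; rewrite mP (root_irreducible irm mw).
Qed.

(** A Bezout relation with the minimal polynomial inverts [P] at [z] and at [w] by one and the same
    [Q]. If both values are 0, then [Q = 0] works because [0^-1 = 0]. *)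
Lemma simple_extension_inverse (i f : {rmorphism K -> L}) (q : {poly K}) (z w : L) :
  q != 0 -> root (map_poly i q) z ->
  (forall P, root (map_poly i P) z = root (map_poly f P) w) ->
  forall P, exists Q, (map_poly i Q).[z] = (map_poly i P).[z]^-1 /\
                      (map_poly f Q).[w] = (map_poly f P).[w]^-1.
Proof.
move=> q0 qz zw P; have [m [irm mP]] := minimal_poly_exists q0 qz.
have mw : root (map_poly f m) w by rewrite -zw mP dvdpp.
have mz : root (map_poly i m) z by rewrite mP dvdpp.
case: (boolP (m %| P)) => [mdP|].
  exists 0; rewrite !rmorph0 !horner0.
  have Pz : root (map_poly i P) z by rewrite mP.
  by move: (Pz); rewrite (zw P) => /eqP ->; rewrite (eqP Pz) invr0.
rewrite -irreducible_poly_coprime // => /Bezout_eq1_coprimepP[[u v] /= uv].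
have inv (g : {rmorphism K -> L}) x : root (map_poly g m) x ->
    (map_poly g v).[x] = (map_poly g P).[x]^-1.
  move=> mx; have := congr1 (fun r => (map_poly g r).[x]) uv.
  rewrite /= rmorphD !rmorphM rmorph1 /= hornerD !hornerM (eqP mx) mulr0 add0r.
  rewrite hornerC => vP; have P0 : (map_poly g P).[x] != 0.
    by apply: contraPneq vP => ->; rewrite mulr0 => /esym/eqP; rewrite oner_eq0.
  by apply: (mulIf P0); rewrite vP mulVf.
by exists v; rewrite !inv.
Qed.

End ConjugateRoots.

(** * Graphs of partial isomorphisms *)

Section GraphField.
Variables (L : fieldType) (R : set (L * L)).

(** An isomorphism between subfields of [L], encoded by its graph in the ring [L * L]. The second
    clause makes both projections injective and every nonzero pair invertible. *)
Definition partial_iso : Prop :=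
  divring_closed (fun u => `[< R u >] : bool) /\
  forall u, R u -> (u.1 == 0) = (u.2 == 0).

Definition graph_pred : pred (L * L) := fun u => `[< R u >].

(* The argument makes the field structure below canonical. *)
Definition graph_field (_ : partial_iso) := {u | graph_pred u}.

Hypothesis isoR : partial_iso.
Local Notation K := (graph_field isoR).

HB.instance Definition _ :=
  GRing.isDivringClosed.Build _ graph_pred (proj1 isoR).
HB.instance Definition _ := SubChoice.on K.
HB.instance Definition _ := [SubChoice_isSubComUnitRing of K by <:].

Lemma graph_fieldP : GRing.field_axiom K.
Proof.
move=> x; rewrite -val_eqE => nx0; suff: val x \is a GRing.unit by [].
case: (val x) nx0 (asboolW (valP x)) => a b nab0 /(proj2 isoR) /= ab0.
have b0 : b != 0.
  by apply: contraNneq nab0 => b0; move: ab0; rewrite b0 eqxx => /eqP ->.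
by rewrite unfold_in /= !unitfE ab0 b0.
Qed.
HB.instance Definition _ := GRing.ComUnitRing_isField.Build K graph_fieldP.

End GraphField.

(** A pair with exactly one zero coordinate would be a non-unit, hence its own inverse; the
    hypothesis excludes this. *)
Lemma inv_pair (L : fieldType) (a b : L) :
  (a == 0) = (b == 0) -> (a, b)^-1 = (a^-1, b^-1) :> L * L.
Proof.
move=> ab; have [b0|b0] := eqVneq b 0.
  have a0 : a = 0 by apply/eqP; rewrite ab b0.
  by rewrite a0 b0 invr0 invr_out ?unitr0.
have U : (a, b) \is a GRing.unit by rewrite unfold_in /= !unitfE ab b0.
apply: (mulrI U); rewrite divrr //.
have -> : (a, b) * (a^-1, b^-1) = (a / a, b / b) by [].
by rewrite !divff // ab.
Qed.

Section FixedField.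
Variables (F L : fieldType) (iota : {rmorphism F -> L}).
Hypothesis closL : is_sep_closure iota.

Definition F_partial_iso (R : set (L * L)) : Prop :=
  partial_iso R /\ forall c, R (iota c, iota c).

Definition simple_extension (K : fieldType) (i f : {rmorphism K -> L}) (z w : L) :
    set (L * L) :=
  [set u | exists P : {poly K}, u = ((map_poly i P).[z], (map_poly f P).[w])].

Lemma simple_extension_iso (K : fieldType) (i f : {rmorphism K -> L})
    (e : {rmorphism F -> K}) (z w : L) :
  i \o e =1 iota -> f \o e =1 iota ->
  (forall P, root (map_poly i P) z = root (map_poly f P) w) ->
  F_partial_iso (simple_extension i f z w).
Proof.
move=> ie fe zw; have [q [q0 [_ qz]]] := proj1 closL z.
have qez : root (map_poly i (map_poly e q)) z.
  rewrite -map_poly_comp; have -> // : map_poly (i \o e) q = map_poly iota q.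
  exact: eq_map_poly.
have qe0 : map_poly e q != 0 by rewrite map_poly_eq0.
split; last first.
  by move=> c; exists (e c)%:P; rewrite !map_polyC !hornerC; congr (_, _); [rewrite -ie|rewrite -fe].
split; last by move=> _ [P ->] /=; have := zw P; rewrite /root.
split.
- by apply/asboolP; exists 1; rewrite !rmorph1 !hornerC.
- move=> _ _ /asboolP[P ->] /asboolP[Q ->]; apply/asboolP; exists (P - Q).
  by rewrite !rmorphB /= !hornerD !hornerN.
move=> _ _ /asboolP[P ->] /asboolP[Q ->]; apply/asboolP.
have [Q' [Q1 Q2]] := simple_extension_inverse qe0 qez zw Q.
exists (P * Q'); rewrite !rmorphM /= !hornerM Q1 Q2 inv_pair //.
by have := zw Q; rewrite /root.
Qed.

Section BaseEmbedding.
Variable R : set (L * L).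
Hypothesis isoR : F_partial_iso R.
Local Notation K := (graph_field (proj1 isoR)).

Definition base_embed (c : F) : K :=
  exist _ (iota c, iota c) (asboolT (proj2 isoR c)).

Lemma base_embed_is_zmod_morphism : zmod_morphism base_embed.
Proof. by move=> c d; apply: val_inj; rewrite rmorphB /= rmorphB. Qed.

Lemma base_embed_is_monoid_morphism : monoid_morphism base_embed.
Proof.
by split=> [|c d]; apply: val_inj; rewrite ?rmorph1 ?rmorphM /= ?rmorph1 ?rmorphM.
Qed.

HB.instance Definition _ :=
  GRing.isZmodMorphism.Build F K base_embed base_embed_is_zmod_morphism.
HB.instance Definition _ :=
  GRing.isMonoidMorphism.Build F K base_embed base_embed_is_monoid_morphism.

Hypothesis maxR : forall B, F_partial_iso B -> R `<=` B -> B `<=` R.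

(** The graph [R] is itself a field [K], embedded in [L] by its two projections. A conjugate [w] of
    [z] yields an extension of [R] containing [(z, w)], which maximality puts back inside [R]. *)
Lemma max_total (z : L) : exists w, R (z, w).
Proof.
pose i : {rmorphism K -> L} := fst \o val.
pose f : {rmorphism K -> L} := snd \o val.
have [q [q0 [sepq qz]]] := proj1 closL z.
have [||| w zw] := @conjugate_root_exists K L i f (map_poly base_embed q) z
  (proj2 closL).
- by rewrite map_poly_eq0.
- by rewrite separable_map.
- by rewrite -map_poly_comp (_ : map_poly _ _ = map_poly iota q) //; exact: eq_map_poly.
have isoE : F_partial_iso (simple_extension i f z w).
  by apply: (@simple_extension_iso K i f base_embed).
exists w; apply: (maxR isoE); last by exists 'X; rewrite !map_polyX !hornerX.
move=> u Ru; have Ku : graph_pred R u by apply/asboolP.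
by exists (exist _ u Ku : K)%:P; rewrite !map_polyC !hornerC; rewrite -surjective_pairing.
Qed.

End BaseEmbedding.

Definition swap (R : set (L * L)) : set (L * L) := [set u | R (u.2, u.1)].

Lemma swap_iso R : F_partial_iso R -> F_partial_iso (swap R).
Proof.
move=> [[[R1 RB RV] R0] RF]; split=> //; split; last first.
  by move=> u /R0 /= ->.
split; first exact: R1.
- move=> [a b] [c d] /asboolP ab /asboolP cd; apply/asboolP.
  by apply: (asboolW (RB (b, a) (d, c) _ _)); apply/asboolP.
- move=> [a b] [c d] /asboolP ab /asboolP cd; apply/asboolP.
  have := asboolW (RV (b, a) (d, c) (asboolT ab) (asboolT cd)).
  have := R0 _ cd => /= dc.
  by rewrite /swap /= !inv_pair.
Qed.

Lemma directed_iso (U : set (L * L)) :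
  (exists u, U u) ->
  (forall u v, U u -> U v -> exists B, [/\ F_partial_iso B, B `<=` U, B u & B v]) ->
  F_partial_iso U.
Proof.
move=> [u0 Uu0] dirU; have [B0 [[[[B01 _ _] _] B0F] B0U _ _]] := dirU _ _ Uu0 Uu0.
split; last by move=> c; apply/B0U/B0F.
split; last by move=> u Uu; have [B [[[_ +] _] _ Bu _]] := dirU _ _ Uu Uu; exact.
split; first by apply/asboolP/B0U/asboolP.
- move=> u v /asboolP Uu /asboolP Uv; apply/asboolP.
  have [B [[[[_ BB _] _] _] BU Bu Bv]] := dirU _ _ Uu Uv.
  by apply/BU/asboolP/BB; apply/asboolP.
- move=> u v /asboolP Uu /asboolP Uv; apply/asboolP.
  have [B [[[[_ _ BV] _] _] BU Bu Bv]] := dirU _ _ Uu Uv.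
  by apply/BU/asboolP/BV; apply/asboolP.
Qed.

Lemma max_iso_exists R0 : F_partial_iso R0 ->
  exists R, [/\ R0 `<=` R, F_partial_iso R &
    forall B, F_partial_iso B -> R `<=` B -> B `<=` R].
Proof.
(* Zorn's lemma also ranges over the empty chain, whose union is empty; adjoining [R0] to every set
   makes the property hold there too. *)
move=> isoR0; have [|A [PA maxA]] := @Zorn_bigcup _ (fun A => F_partial_iso (A `|` R0)).
  move=> C CP totC; apply: directed_iso.
    by exists (iota 0, iota 0); right; apply: (proj2 isoR0).
  have sub X : C X -> X `|` R0 `<=` \bigcup_(X in C) X `|` R0.
    by move=> CX u [Xu|R0u]; [left; exists X|right].
  move=> u v [[X CX Xu]|R0u] [[Y CY Yv]|R0v].
  - have [XY|YX] := totC _ _ CX CY.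
      by exists (Y `|` R0); split; [exact: CP|exact: sub|left; exact: XY|left].
    by exists (X `|` R0); split; [exact: CP|exact: sub|left|left; exact: YX].
  - by exists (X `|` R0); split; [exact: CP|exact: sub|left|right].
  - by exists (Y `|` R0); split; [exact: CP|exact: sub|right|left].
  - by exists R0; split => //; move=> ? ?; right.
exists (A `|` R0); split=> // B isoB AB u Bu.
apply: contrapT => nRu.
have AltB : A `<` B.
  split=> [v Av|BA]; first by apply: AB; left.
  by apply: nRu; left; apply: BA.
by apply: (maxA B AltB); rewrite setUidl => // v R0v; apply: AB; right.
Qed.

(** A maximal extension of [R0] is total, and so is its swap, which is maximal as well; hence it is
    the graph of an automorphism. It is single-valued because a difference with one zero coordinate
    is zero. *)
Lemma iso_inG R0 : F_partial_iso R0 ->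
  exists s, inG iota s /\ forall x y, R0 (x, y) -> s x = y.
Proof.
move=> /max_iso_exists[R [R0R isoR maxR]].
have [s Rs] := choice (max_total isoR maxR).
have maxR' B : F_partial_iso B -> swap R `<=` B -> B `<=` swap R.
  move=> isoB RB [a b] Bab; apply: (maxR _ (swap_iso isoB)) => // -[c d] Rcd.
  exact: RB.
have [t Rt] := choice (max_total (swap_iso isoR) maxR').
have [[[R1 RB RV] Rz] RF] := isoR.
have fun1 x y y' : R (x, y) -> R (x, y') -> y = y'.
  move=> Rxy Rxy'; have /asboolW/Rz/= := RB _ _ (asboolT Rxy) (asboolT Rxy').
  by rewrite subrr eqxx => /esym; rewrite subr_eq0 => /eqP.
have fun2 x x' y : R (x, y) -> R (x', y) -> x = x'.
  move=> Rxy Rxy'; have /asboolW/Rz/= := RB _ _ (asboolT Rxy) (asboolT Rxy').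
  by rewrite subrr eqxx subr_eq0 => /eqP.
have R0' : R (0, 0).
  by have := asboolW (RB _ _ R1 R1); rewrite subrr.
have RN x y : R (x, y) -> R (- x, - y).
  move=> Rxy; have /asboolW := RB _ _ (asboolT R0') (asboolT Rxy).
  by rewrite sub0r.
have RD x y x' y' : R (x, y) -> R (x', y') -> R (x + x', y + y').
  move=> Rxy /RN Rxy'; have /asboolW := RB _ _ (asboolT Rxy) (asboolT Rxy').
  have -> // : (x, y) - (- x', - y') = (x - - x', y - - y') by [].
  by rewrite !opprK.
have RI x y : R (x, y) -> R (x^-1, y^-1).
  move=> Rxy; have /asboolW := RV _ _ R1 (asboolT Rxy).
  rewrite inv_pair; last exact: (Rz _ Rxy).
  by rewrite mul1r.
have RM x y x' y' : R (x, y) -> R (x', y') -> R (x * x', y * y').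
  move=> Rxy Rxy'; have /asboolW := RV _ _ (asboolT Rxy) (asboolT (RI _ _ Rxy')).
  rewrite inv_pair; last exact: (Rz _ (RI _ _ Rxy')).
  by rewrite !invrK.
exists s; split=> [|x y /R0R]; last exact: fun1.
split.
- by move=> x y; apply: (fun1 (x + y)) => //; apply: RD.
- by move=> x y; apply: (fun1 (x * y)) => //; apply: RM.
- by apply: (fun1 1); [exact: Rs|exact: (asboolW R1)].
- by exists t => x; [apply: (fun2 _ _ (s x))|apply: (fun1 (t x))] => //; apply: Rt.
- by move=> c; apply: (fun1 (iota c)).
Qed.

(** If the minimal polynomial of [x] is not linear, separability gives a second root [y], and
    [x |-> y] extends to an automorphism moving [x]. So it is linear, and [x] is read off its two
    coefficients. *)
Lemma fixed_field (x : L) :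
  (forall s, inG iota s -> s x = x) -> exists c, x = iota c.
Proof.
move=> fixx; have [q [q0 [sepq qx]]] := proj1 closL x.
have [m [irm mP]] := minimal_poly_exists q0 qx.
have mx : root (map_poly iota m) x by rewrite mP.
have sepm : separable_poly m by apply: dvdp_separable sepq; rewrite -mP.
have m1 : (1 < size m)%N by case: irm.
have [r mr] := factor_theorem _ _ mx.
have m0 : map_poly iota m != 0 by rewrite map_poly_eq0 -size_poly_gt0 ltnW.
have r0 : r != 0 by apply: contraNneq m0 => r0; rewrite mr r0 mul0r.
have sepr : separable_poly (r * ('X - x%:P)) by rewrite -mr separable_map.
move: (sepr); rewrite separable_mul => /and3P[sepr1 _ copr].
have sm : size m = (size r).+1.
  rewrite -(size_map_poly iota) mr size_Mmonic ?monicXsubC //.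
  by rewrite size_XsubC addn2.
have [r1|r1] := ltnP 1 (size r).
  have [y ry] := proj2 closL r r1 sepr1.
  have my : root (map_poly iota m) y by rewrite mr rootM ry.
  have xy P : root (map_poly iota P) x = root (map_poly iota P) y.
    by rewrite mP (root_irreducible irm my).
  have [s [Gs sR]] := iso_inG (@simple_extension_iso F iota iota idfun x y
    (frefl _) (frefl _) xy).
  have : s x = y by apply: sR; exists 'X; rewrite !map_polyX !hornerX.
  rewrite (fixx _ Gs) => yx; move: copr; rewrite coprimep_XsubC.
  by rewrite yx ry.
have {}sm : size m = 2 by apply/eqP; rewrite sm eqSS eqn_leq r1 -ltnS -sm.
exists (- m`_0 / m`_1).
have lm : m`_1 != 0.
  have : lead_coef m != 0 by rewrite lead_coef_eq0 -size_poly_gt0 sm.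
  by rewrite lead_coefE sm.
have := eqP mx; rewrite horner_coef size_map_poly sm !big_ord_recl big_ord0 /=.
rewrite !coef_map /= expr0 mulr1 addr0 expr1 => /eqP.
rewrite addrC addr_eq0 => /eqP mxe; rewrite fmorph_div rmorphN /= -mxe mulrC mulKf //.
by rewrite fmorph_eq0.
Qed.
End FixedField.

(** * The affine group acting on truncated polynomials *)

Section AffineMatrix.
Variable R : comNzRingType.

(* In the basis [X^k], the matrix of [f(X) |-> (1+X)^b f((1+X)^t - 1)]: the
   action of the affine map [x |-> t x + b] on the completed group ring. *)
Definition affine_poly (b t k : nat) : {poly R} :=
  (1 + 'X) ^+ b * ((1 + 'X) ^+ t - 1) ^+ k.
Definition affine_coef (b t k j : nat) : R := (affine_poly b t k)`_j.

Lemma affine_polyE (t : nat) : exists g : {poly R},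
  (1 + 'X) ^+ t - 1 = 'X * g /\ forall i, g`_i = 'C(t, i.+1)%:R.
Proof.
exists (\sum_(i < t) (1 + 'X) ^+ i).
have e : (1 + 'X) ^+ t - 1 = 'X * \sum_(i < t) (1 + 'X) ^+ i :> {poly R}.
  by rewrite subrX1 addrAC subrr add0r.
split=> // i; have := congr1 (fun r : {poly R} => r`_i.+1) e.
rewrite /= coefXM /= => <-; rewrite coefB coef1 subr0 exprDn coef_sum.
have [it|ti] := ltnP i.+1 t.+1; last first.
  rewrite bin_small // big1 // => k _.
  rewrite expr1n mul1r coefMn coefXn gtn_eqF ?mul0rn //.
  exact: leq_trans (ltn_ord k) ti.
rewrite (bigD1 (Ordinal it)) //= big1 ?addr0.
  by rewrite expr1n mul1r coefMn coefXn eqxx.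
move=> k ki; rewrite expr1n mul1r coefMn coefXn eq_sym.
by rewrite -[(k : nat) == _]/(k == Ordinal it) (negPf ki) mul0rn.
Qed.

Lemma affine_coef_gt (b t k j : nat) : (j < k)%N -> affine_coef b t k j = 0.
Proof.
move=> jk; have [g [e _]] := affine_polyE t.
by rewrite /affine_coef /affine_poly e exprMn mulrCA coefXnM jk.
Qed.

(** Substituting [(1 + X)^t - 1] for [X] and multiplying by [(1 + X)^b] composes the affine maps;
    expanding in powers of [X] gives the matrix product, with the two factors in reversed order. *)
Lemma affine_coef_comp (b t b' t' k j : nat) : (k <= j)%N ->
  affine_coef (b + t * b') (t * t') k j =
  \sum_(k <= l < j.+1) affine_coef b' t' k l * affine_coef b t l j.
Proof.
move=> kj; rewrite {1}/affine_coef.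
pose P := affine_poly b' t' k.
have -> : affine_poly (b + t * b') (t * t') k =
    (1 + 'X) ^+ b * (P \Po ((1 + 'X) ^+ t - 1)).
  rewrite comp_polyM rmorphXn rmorphXn rmorphB rmorphXn rmorphD /=.
  rewrite comp_polyX comp_polyC -polyC1 /=.
  by rewrite (addrC 1%:P (_ - _)) subrK /affine_poly exprD mulrA -!exprM.
have -> : (1 + 'X) ^+ b * (P \Po ((1 + 'X) ^+ t - 1)) =
    \sum_(0 <= l < size P) P`_l *: affine_poly b t l.
  rewrite comp_polyE mulr_sumr big_mkord; apply: eq_bigr => l _.
  by rewrite scalerAr.
rewrite coef_sum; pose G l := affine_coef b' t' k l * affine_coef b t l j.
rewrite (eq_bigr G) => [|l _]; last by rewrite coefZ.
(* [size P] may lie on either side of [j], so the range is enlarged to cover both before it is cut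
   at [j] and at [k]. *)
have -> : \sum_(0 <= l < size P) G l = \sum_(0 <= l < size P + j.+1) G l.
  rewrite [RHS](big_cat_nat (n := size P)) ?leq_addr //=.
  rewrite [X in _ + X]big_nat_cond [X in _ + X]big1 ?addr0 // => l /andP[/andP[Pl _] _].
  by rewrite /G {1}/affine_coef nth_default // mul0r.
rewrite (big_cat_nat (n := j.+1)) ?leq_addl //=.
rewrite [X in _ + X]big_nat_cond [X in _ + X]big1 ?addr0 => [|l /andP[/andP[jl _] _]]; last first.
  by rewrite /G [affine_coef b t l j]affine_coef_gt // mulr0.
rewrite (big_cat_nat (n := k)) ?(leq_trans kj) //=.
rewrite big_nat_cond big1 ?add0r // => l /andP[/andP[_ lk] _].
by rewrite /G affine_coef_gt // mul0r.
Qed.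

End AffineMatrix.

Section AffineMatrixModP.
Variable p : nat.
Hypotheses (p_prime : prime p) (p_odd : odd p).
Local Notation M := (affine_coef 'F_p).

Lemma coef1M (u v : {poly 'F_p}) : (u * v)`_1 = u`_0 * v`_1 + u`_1 * v`_0.
Proof. by rewrite coefM !big_ord_recl !big_ord0 /= !addr0. Qed.

(** [2 C(t, 2) = t (t - 1)] is divisible by [p], and 2 can be cancelled. This is where the oddness
    of [p] enters. *)
Lemma dvdn_bin2 t : t = 1 %[mod p] -> (p %| 'C(t, 2))%N.
Proof.
move=> t1; rewrite -(Gauss_dvdr _ (_ : coprime p 2)); last first.
  by rewrite coprime_sym prime_coprime // dvdn2 p_odd.
rewrite bin2 mul2n; case: t t1 => [|t] t1; first by rewrite muln0.
rewrite halfK oddM /= andNb subn0 dvdn_mull //.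
have : t.+1 = 1 + 0 %[mod p] by [].
by rewrite -add1n => /eqP; rewrite eqn_modDl mod0n.
Qed.

Lemma natr_Fp_mod k l : k = l %[mod p] -> k%:R = l%:R :> 'F_p.
Proof. by move=> kl; apply: val_inj; rewrite [LHS]val_Fp_nat // [RHS]val_Fp_nat. Qed.

(** Write [(1 + X)^t - 1 = X g]. The first two coefficients of [g] are [t = 1] and [C(t, 2) = 0], so
    only the factor [(1 + X)^b] contributes to the entry next to the diagonal. *)
Lemma affine_coef_unip (b t k : nat) : t = 1 %[mod p] ->
  M b t k k = 1 /\ M b t k k.+1 = b%:R.
Proof.
move=> t1; have [g [e gi]] := affine_polyE 'F_p t.
have g0 : g`_0 = 1.
  by rewrite gi bin1 (natr_Fp_mod t1).
have g1 : g`_1 = 0.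
  rewrite gi; apply/eqP; rewrite -(dvdn_pcharf (pchar_Fp p_prime)).
  exact: dvdn_bin2.
have [gk0 gk1] : (g ^+ k)`_0 = 1 /\ (g ^+ k)`_1 = 0.
  elim: k => [|k [IH0 IH1]]; first by rewrite expr0 !coef1.
  by rewrite exprS !(coef0M, coef1M) IH0 IH1 g0 g1 !mulr0 mul0r mulr1 addr0.
have [h [eh hi]] := affine_polyE 'F_p b.
have hb : (1 + 'X) ^+ b = 1 + 'X * h by rewrite -eh [RHS]addrC subrK.
have [-> ->] : M b t k k = ((1 + 'X * h) * g ^+ k)`_0 /\
           M b t k k.+1 = ((1 + 'X * h) * g ^+ k)`_1.
  rewrite /affine_coef /affine_poly e hb exprMn mulrCA !coefXnM ltnn ltnNge leqnSn /=.
  by rewrite subnn subSnn.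
rewrite !(coef0M, coef1M) gk0 gk1 !coefD !coefXM !coef1 /= hi bin1.
by rewrite !addr0 !mulr1 mulr0 !add0r.
Qed.

Lemma dvdp_subM (d u v u' v' : {poly 'F_p}) :
  d %| u - u' -> d %| v - v' -> d %| u * v - u' * v'.
Proof.
move=> du dv; have -> : u * v - u' * v' = (u - u') * v + u' * (v - v').
  by rewrite mulrBl mulrBr addrA subrK.
by apply: dvdp_add; [exact: dvdp_mulr|exact: dvdp_mull].
Qed.

Lemma dvdp_subX (d u u' : {poly 'F_p}) k : d %| u - u' -> d %| u ^+ k - u' ^+ k.
Proof. by move=> du; rewrite subrXX dvdp_mulr. Qed.

(** In characteristic [p], [(1 + X)^(p^N) = 1 + X^(p^N)], which is 1 modulo [X^(p^N)]. *)
Lemma dvdp_expr_mod (N b b' : nat) : b = b' %[mod p ^ N] ->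
  'X^(p ^ N) %| ((1 + 'X) ^+ b - (1 + 'X) ^+ b' : {poly 'F_p}).
Proof.
have red c : 'X^(p ^ N) %| ((1 + 'X) ^+ c - (1 + 'X) ^+ (c %% p ^ N) : {poly 'F_p}).
  rewrite {1}(divn_eq c (p ^ N)) exprD mulnC exprM -[X in _ - X]mul1r.
  apply: dvdp_subM; last by rewrite subrr dvdp0.
  rewrite -{2}(expr1n _ (c %/ p ^ N)); apply: dvdp_subX.
  rewrite exprDn_pchar ?expr1n; last first.
    by rewrite pnatX; apply/orP; left; rewrite pnatE // pchar_poly pchar_Fp.
  by rewrite addrAC subrr add0r dvdpp.
move=> bb'; have := dvdp_sub (red b) (red b').
by rewrite bb' opprB addrA subrK.
Qed.

Lemma affine_coef_mod (N b t b' t' k j : nat) :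
  b = b' %[mod p ^ N] -> t = t' %[mod p ^ N] -> (j < p ^ N)%N ->
  M b t k j = M b' t' k j.
Proof.
move=> bb' tt' jN; apply/eqP; rewrite -subr_eq0 -coefB; apply/eqP.
have /dvdpP[r ->] : 'X^(p ^ N) %| affine_poly 'F_p b t k - affine_poly 'F_p b' t' k.
  apply: dvdp_subM; first exact: dvdp_expr_mod.
  apply: dvdp_subX; rewrite opprB addrA subrK.
  exact: dvdp_expr_mod.
by rewrite coefMXn jN.
Qed.

End AffineMatrixModP.

(** * Kummer theory *)

Section Kummer.
Variables (F L : fieldType) (iota : {rmorphism F -> L}).
Hypothesis closL : is_sep_closure iota.
Local Notation inG := (inG iota).

Lemma inG_rmorphism s : inG s -> exists f : {rmorphism L -> L}, f =1 s.
Proof.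
case=> sD sM s1 _ _.
have sB : zmod_morphism s.
  move=> x y; apply: (addIr (s y)).
  by rewrite -sD !subrK.
pose b1 := GRing.isZmodMorphism.Build L L s sB.
pose b2 := GRing.isMonoidMorphism.Build L L s (conj s1 sM).
pose f : {rmorphism L -> L} := HB.pack s b1 b2.
by exists f.
Qed.

Lemma inG_id : inG id.
Proof. by split=> //; exists id. Qed.

Lemma inG_comp s t : inG s -> inG t -> inG (s \o t).
Proof.
move=> [sD sM s1 bs sF] [tD tM t1 bt tF]; split=> /=.
- by move=> x y; rewrite tD sD.
- by move=> x y; rewrite tM sM.
- by rewrite t1.
- exact: bij_comp.
- by move=> c; rewrite tF.
Qed.

Lemma inG_inv s : inG s -> exists2 t, inG t & s \o t = id /\ t \o s = id.
Proof.
move=> [sD sM s1 [t stK tsK] sF]; exists t.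
  split.
  - by move=> x y; apply: (can_inj stK); rewrite sD !tsK.
  - by move=> x y; apply: (can_inj stK); rewrite sM !tsK.
  - by apply: (can_inj stK); rewrite s1 tsK.
  - by exists s.
  - by move=> c; apply: (can_inj stK); rewrite sF tsK.
by split; apply: funext => x /=; rewrite ?stK ?tsK.
Qed.

Lemma roots_finite (p : {poly L}) : p != 0 ->
  exists rs : seq L, forall x, root p x -> x \in rs.
Proof.
have [n] := ubnP (size p); elim: n p => // n IHn p szp p0.
have [[x px]|nroot] := EM (exists x, root p x); last first.
  by exists [::] => x px; case: nroot; exists x.
have [r pr] := factor_theorem _ _ px.
have r0 : r != 0 by apply: contraNneq p0 => r0; rewrite pr r0 mul0r.
have [|rs rsP] := IHn r _ r0.
  move: szp; rewrite pr size_Mmonic ?monicXsubC // size_XsubC addn2 /=.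
  by [].
exists (x :: rs) => y; rewrite pr rootM root_XsubC inE orbC => /orP[->//|/rsP->].
by rewrite orbT.
Qed.

(** Each [x] is a root of a nonzero polynomial over [F], whose finitely many roots in [L] are
    preserved by G. *)
Lemma stable_closure (S : seq L) : exists T : seq L,
  {subset S <= T} /\ forall s, inG s -> forall x, x \in T -> s x \in T.
Proof.
elim: S => [|x S [T [ST GT]]]; first by exists [::].
have [q [q0 [_ qx]]] := proj1 closL x.
have [rs rsP] : exists rs : seq L, forall y, root (map_poly iota q) y -> y \in rs.
  by apply: roots_finite; rewrite map_poly_eq0.
(* The list [rs] may contain elements that are not roots; these are filtered out to keep
   stability. *)
exists ([seq y <- rs | root (map_poly iota q) y] ++ T); split.
  move=> y; rewrite inE mem_cat mem_filter => /orP[/eqP ->|/ST ->].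
    by rewrite qx rsP.
  by rewrite orbT.
move=> s Gs y; rewrite !mem_cat !mem_filter => /orP[/andP[qy _]|/(GT s Gs) ->].
  have [f fs] := inG_rmorphism Gs.
  have qsy : root (map_poly iota q) (s y).
    have <- : map_poly f (map_poly iota q) = map_poly iota q.
      rewrite -map_poly_comp; apply: eq_map_poly => c /=.
      by rewrite fs; case: Gs.
    by rewrite -fs /root horner_map (eqP qy) rmorph0.
  by rewrite qsy rsP.
by rewrite orbT.
Qed.

(* Dedekind's independence of characters, on a submonoid [M] of [L]. *)
Lemma characters_independent (I : finType) (s : I -> L -> L) (M : L -> Prop)
    (A : {set I}) (c : I -> L) :
  M 1 -> (forall x y, M x -> M y -> M (x * y)) ->
  (forall i, s i 1 = 1) -> (forall i x y, s i (x * y) = s i x * s i y) ->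
  {in A &, forall i j, i != j -> exists x, M x /\ s i x != s j x} ->
  (forall x, M x -> \sum_(i in A) c i * s i x = 0) ->
  {in A, forall i, c i = 0}.
Proof.
move=> M1 MM s1 sM; have [n] := ubnP #|A|.
elim: n A c => // n IHn A c szA sepA sumA i iA.
have [[j [jA ji]]|nj] := EM (exists j, j \in A /\ j != i); last first.
  have := sumA 1 M1; rewrite (bigD1 i) //= s1 mulr1 big1 ?addr0 // => j /andP[jA ji].
  by case: nj; exists j.
have [x [Mx sx]] := sepA i j iA jA (contra_neq esym ji).
suff /eqP : c i * (s i x - s j x) = 0.
  by rewrite mulf_eq0 subr_eq0 (negPf sx) orbF => /eqP.
apply: (IHn (A :\ j) (fun k => c k * (s k x - s j x))).
- by move: szA; rewrite (cardsD1 j) jA.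
- by move=> k l /setD1P[_ kA] /setD1P[_ lA]; apply: sepA.
- move=> y My; have := sumA (x * y) (MM _ _ Mx My).
  have /(congr1 (fun z => s j x * z)) := sumA y My.
  rewrite mulr0 mulr_sumr => e1 e2; have := congr2 (fun a b => a - b) e2 e1.
  rewrite /= subr0 -sumrB (bigD1 j) //= sM.
  have -> : c j * (s j x * s j y) - s j x * (c j * s j y) = 0.
    by rewrite mulrCA subrr.
  rewrite add0r => e; rewrite -[RHS]e; apply: eq_big => [k|k _].
    by rewrite !inE andbC.
  by rewrite sM mulrBr mulrBl -!mulrA (mulrCA (s j x)).
- by rewrite !inE eq_sym ji.
Qed.

Variables (p : nat) (zeta : F).
Hypotheses (p_prime : prime p) (zeta_prim : p.-primitive_root zeta).

Definition root_char (a : 'F_p) : L := iota zeta ^+ nat_of_ord a.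
Local Notation z := root_char.

Lemma root_char_prim : p.-primitive_root (iota zeta).
Proof. by rewrite fmorph_primitive_root. Qed.

Lemma val_natFp k : nat_of_ord (k%:R : 'F_p) = (k %% p)%N.
Proof. by rewrite val_Fp_nat. Qed.

Lemma ltn_Fp (a : 'F_p) : (a < p)%N.
Proof. by have := ltn_ord a; rewrite [X in (_ < X)%N -> _]Fp_cast. Qed.

Lemma root_char_nat k : z k%:R = iota zeta ^+ k.
Proof. by rewrite /z val_natFp (prim_expr_mod root_char_prim). Qed.

Lemma root_charD a b : z (a + b) = z a * z b.
Proof.
by rewrite -[a]natr_Zp -[b]natr_Zp -natrD !root_char_nat exprD.
Qed.

Lemma root_char0 : z 0 = 1. Proof. by []. Qed.

Lemma root_char_inj : injective z.
Proof.
move=> a b /eqP; rewrite (eq_prim_root_expr root_char_prim) !modn_small ?ltn_Fp //.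
by move=> /eqP /val_inj.
Qed.

Lemma root_char_exp a : z a ^+ p = 1.
Proof. by rewrite exprAC (prim_expr_order root_char_prim) expr1n. Qed.

Lemma root_char_neq0 a : z a != 0.
Proof.
apply: contraTneq isT => za0; have /eqP := root_char_exp a.
by rewrite za0 expr0n gtn_eqF ?prime_gt0 // eq_sym oner_eq0.
Qed.

Lemma root_char_fixed s a : inG s -> s (z a) = z a.
Proof.
by move=> Gs; case: (Gs) => _ _ _ _ sF; rewrite /z -rmorphXn /= sF.
Qed.

(** A Kummer generator: [beta^p] lies in [F], and [chi] is its Kummer character. *)
Definition eigen_vector (chi : cochain1 L p) (beta : L) : Prop :=
  beta != 0 /\ forall s, inG s -> s beta = z (chi s) * beta.

Lemma H1eltM (chi : cochain1 L p) s t : H1elt iota chi -> inG s -> inG t ->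
  chi (s \o t) = chi s + chi t.
Proof.
move=> [_ h] Gs Gt; have := h s t Gs Gt; rewrite /cobound1 => /eqP.
by rewrite addrAC subr_eq0 => /eqP <-; rewrite addrC.
Qed.

(* Hilbert 90: the Lagrange resolvent over a finite set of representatives of
   the restrictions of the automorphisms to a finite stable set. *)
Lemma eigen_vector_exists (chi : cochain1 L p) :
  H1elt iota chi -> exists beta, eigen_vector chi beta.
Proof.
(* Continuity at the identity alone suffices: as [chi] is additive, it depends only on the
   restriction to a stable finite set containing [S0]. *)
move=> Hchi; have [S0 S0P] := proj1 Hchi id inG_id.
have chi_id : chi id = 0.
  have := H1eltM Hchi inG_id inG_id; rewrite (_ : id \o id = id) //.
  by move/eqP; rewrite addrC -subr_eq subrr => /eqP.
have [S [S0S stabS]] := stable_closure S0.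
pose agree (s t : L -> L) := forall x, x \in S -> s x = t x.
have chi_agree s t : inG s -> inG t -> agree s t -> chi s = chi t.
  move=> Gs Gt st; have [s' Gs' [ss' s's]] := inG_inv Gs.
  have : chi (s' \o t) = chi id.
    apply: S0P => [|x /S0S Sx]; first exact: inG_comp.
    by rewrite /= -st // -[LHS]/((s' \o s) x) s's.
  rewrite H1eltM // chi_id => /eqP; rewrite addrC addr_eq0 => /eqP ->.
  have : chi (s \o s') = chi id by rewrite ss'.
  by rewrite H1eltM // chi_id => /eqP; rewrite addr_eq0 => /eqP.
(* [res s] codes the restriction of [s] to [S] by list indices, in a finite type; the extra value
   [m] is the index of an absent element. *)
pose m := size S; pose I := {ffun 'I_m -> 'I_m.+1}.
pose res (s : L -> L) : I := [ffun i : 'I_m => inord (index (s (nth 0 S i)) S)].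
have resP s t : inG s -> inG t -> res s = res t <-> agree s t.
  move=> Gs Gt; split=> [/ffunP st x Sx|st]; last first.
    by apply/ffunP => i; rewrite !ffunE st // mem_nth.
  have xm : (index x S < m)%N by rewrite index_mem.
  have := st (Ordinal xm); rewrite !ffunE /= nth_index // => /(congr1 val).
  rewrite /= !inordK ?ltnS ?index_size // => e.
  by rewrite -(nth_index 0 (stabS s Gs x Sx)) e nth_index // stabS.
have /choice[rep repP] : forall f : I, exists r,
    inG r /\ ((exists s, inG s /\ res s = f) -> res r = f).
  move=> f; have [[s [Gs sf]]|no] := EM (exists s, inG s /\ res s = f).
    by exists s.
  by exists id; split=> //; exact: inG_id.
pose A := finset (fun f : I => `[< exists s, inG s /\ res s = f >]).
have repA f : f \in A -> res (rep f) = f.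
  by rewrite inE => /asboolP; apply: (proj2 (repP f)).
have Grep f : inG (rep f) by case: (repP f).
have resA s : inG s -> res s \in A by move=> Gs; rewrite inE; apply/asboolP; exists s.
(* [M] stands in for the field generated by [S]: on it the action depends only on the restriction to
   [S]. *)
pose M x := forall s t, inG s -> inG t -> agree s t -> s x = t x.
have [x [Mx sumx]] : exists x, M x /\ \sum_(f in A) z (- chi (rep f)) * rep f x != 0.
  apply: contrapT => no.
  have Mid : M 1 by move=> s t [_ _ s1 _ _] [_ _ t1 _ _] _; rewrite s1 t1.
  have MM y y' : M y -> M y' -> M (y * y').
    move=> My My' s t Gs Gt st; have [_ sM _ _ _] := Gs; have [_ tM _ _ _] := Gt.
    by rewrite sM tM (My s t) // (My' s t).
  have rep1 f : rep f 1 = 1 by case: (Grep f).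
  have repM f y y' : rep f (y * y') = rep f y * rep f y' by case: (Grep f).
  have sep : {in A &, forall f g, f != g -> exists y, M y /\ rep f y != rep g y}.
    move=> f g fA gA fg; apply: contrapT => noy; case/eqP: fg.
    rewrite -(repA f fA) -(repA g gA); apply/resP => // y Sy.
    apply: contrapT => /eqP fgy; apply: noy; exists y; split=> //.
    by move=> s t _ _; apply.
  have sum0 y : M y -> \sum_(f in A) z (- chi (rep f)) * rep f y = 0.
    by move=> My; apply: contrapT => /eqP ny; apply: no; exists y.
  have /eqP := characters_independent Mid MM rep1 repM sep sum0 (resA _ inG_id).
  by rewrite (negPf (root_char_neq0 _)).
exists (\sum_(f in A) z (- chi (rep f)) * rep f x); split=> // t Gt.
(* Composition with [t] permutes the restrictions; reindexing the resolvent along [h] pulls out the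
   factor [z (chi t)]. *)
pose h f := res (t \o rep f).
have Gtr f : inG (t \o rep f) by apply: inG_comp.
have agr f : f \in A -> agree (t \o rep f) (rep (h f)).
  move=> fA; apply/resP => //; by rewrite repA //; apply: resA.
have hA : {in A &, injective h}.
  move=> f g fA gA fg; rewrite -(repA f fA) -(repA g gA); apply/resP => // y Sy.
  have [_ _ _ bt _] := Gt; apply: (bij_inj bt).
  by rewrite -[LHS]/((t \o rep f) y) (agr f fA) // fg -(agr g gA).
have AhA : h @: A = A.
  apply/eqP; rewrite eqEcard card_in_imset // leqnn andbT.
  by apply/fintype.subsetP => _ /imsetP[f fA ->]; apply: resA.
have [u ut] := inG_rmorphism Gt.
rewrite -ut rmorph_sum -{2}AhA big_imset // mulr_sumr; apply: eq_bigr => f fA.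
rewrite rmorphM /= !ut root_char_fixed // mulrA -root_charD.
rewrite -[t (rep f x)]/((t \o rep f) x) (Mx _ _ (Gtr f) (Grep (h f)) (agr f fA)).
rewrite -(chi_agree _ _ (Gtr f) (Grep (h f)) (agr f fA)) H1eltM //.
by rewrite opprD addrA subrr add0r.
Qed.

Lemma root_charMn k a : z (k%:R * a) = z a ^+ k.
Proof.
elim: k => [|k IHk]; first by rewrite mul0r expr0.
by rewrite exprS -IHk -root_charD -natr1 mulrDl mul1r addrC.
Qed.

Lemma eigen_vector_pth_power (chi : cochain1 L p) beta :
  eigen_vector chi beta -> exists a, beta ^+ p = iota a.
Proof.
move=> [_ bchi]; apply: (fixed_field closL) => s Gs.
have [f fs] := inG_rmorphism Gs.
by rewrite -fs rmorphXn /= fs bchi // exprMn root_char_exp mul1r.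
Qed.

Lemma pth_root_unity (x y : L) : y != 0 -> x ^+ p = y ^+ p ->
  exists i : nat, x = iota zeta ^+ i * y.
Proof.
move=> y0 xy; have : (x / y) ^+ p = 1 by rewrite expr_div_n xy divff // expf_neq0.
by case/(prim_rootP root_char_prim) => i e; exists i; rewrite -e divfK.
Qed.

(* The p-th powers of the eigenvectors of [alpha] and [beta] are the elements of
   [F] of which these are the Kummer characters. *)
Lemma rigid_proportional (alpha beta : cochain1 L p) :
  p_rigid iota p zeta -> H1elt iota alpha -> H1elt iota beta ->
  (exists s, inG s /\ alpha s != 0) -> H2zero iota (cup11 alpha beta) ->
  exists k, forall s, inG s -> beta s = k * alpha s.
Proof.
move=> rigid Ha Hb [s0 [Gs0 as0]] cup0.
have [x [x0 xa]] := eigen_vector_exists Ha.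
have [y [y0 yb]] := eigen_vector_exists Hb.
have [a ax] := eigen_vector_pth_power (conj x0 xa).
have [b by_] := eigen_vector_pth_power (conj y0 yb).
have p_gt0 := prime_gt0 p_prime.
(* Otherwise [x] would be a root of unity times an element of [F], hence fixed by [s0], against
   [alpha s0 != 0]. *)
have nza : not_pth_power p a.
  split=> [|[c ac]].
    by rewrite -(fmorph_eq0 iota) -ax expf_neq0.
  have c0 : iota c != 0.
    apply: contraNneq x0 => c0; move: ax; rewrite ac rmorphXn c0 expr0n gtn_eqF //.
    by move/eqP; rewrite expf_eq0 p_gt0.
  have [|i xi] := @pth_root_unity x (iota c) c0; first by rewrite ax ac rmorphXn.
  case/eqP: as0; apply: root_char_inj; rewrite root_char0; apply: (mulIf x0).
  rewrite -xa // mul1r xi -rmorphXn -rmorphM.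
  by case: Gs0 => _ _ _ _ ->.
have b0 : b != 0 by rewrite -(fmorph_eq0 iota) -by_ expf_neq0.
have [||i [c [c0 bac]]] := proj2 (rigid a nza) b b0 alpha beta _ _ cup0.
- by exists x; split.
- by exists y; split.
have xc0 : x ^+ i * iota c != 0 by rewrite mulf_neq0 ?expf_neq0 ?fmorph_eq0.
have [|j yj] := @pth_root_unity y (x ^+ i * iota c) xc0.
  by rewrite by_ bac rmorphM !rmorphXn -ax exprMn -!exprM mulnC.
exists i%:R => s Gs; apply: root_char_inj; apply: (mulIf y0); rewrite -yb //.
have [f fs] := inG_rmorphism Gs; have [_ _ _ _ sF] := Gs.
rewrite root_charMn yj -fs !rmorphM !rmorphXn /= !fs !sF xa // exprMn.
by rewrite -mulrA mulrCA.
Qed.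

(** * Unipotent systems *)

Lemma separable_XnsubC (m : nat) (c : L) :
  m%:R != 0 :> L -> c != 0 -> separable_poly ('X^m - c%:P).
Proof.
case: m => [|m]; first by rewrite eqxx.
move=> m0 c0; rewrite separable_poly.unlock derivB derivXn derivC subr0 /=.
(* With [d = m + 1], the relation is [(X / (d c)) (d X^m) - (X^d - c) / c = 1]. *)
apply/Bezout_eq1_coprimepP; exists (- (c^-1)%:P, ((m.+1%:R * c)^-1)%:P * 'X) => /=.
have -> : ((m.+1%:R * c)^-1)%:P * 'X * ('X^m *+ m.+1) =
    (c^-1)%:P * 'X^(m.+1).
  have e : (m.+1%:R * c)^-1 *+ m.+1 = c^-1.
    by rewrite -[LHS]mulr_natr invfM mulrAC mulVf // mul1r.
  by rewrite -mulrA !mulrnAr -exprS -mulrnAl -polyCMn e.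
rewrite mulNr mulrBr -polyCM mulVf // opprB.
by rewrite subrK.
Qed.

(** In characteristic [p], Frobenius would give [(zeta - 1)^p = zeta^p - 1 = 0], so [zeta = 1],
    which is not of order [p]. *)
Lemma pexp_natr_neq0 n : (p ^ n)%:R != 0 :> L.
Proof.
rewrite natrX expf_neq0 //; apply/negP => p0.
have pL : p \in [pchar L] by rewrite inE /= p_prime p0.
have : (iota zeta - 1) ^+ p = 0.
  rewrite -(pFrobenius_autE pL) rmorphB /= pFrobenius_autE rmorph1.
  by rewrite (prim_expr_order root_char_prim) subrr.
move/eqP; rewrite expf_eq0 prime_gt0 //= subr_eq0 => /eqP z1.
have := eq_prim_root_expr root_char_prim 0 1.
by rewrite expr0 expr1 z1 eqxx !modn_small ?prime_gt0 ?prime_gt1.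
Qed.

Lemma root_exists n (x : L) : x != 0 -> exists y, y ^+ (p ^ n) = x.
Proof.
move=> x0; have [||y] := proj2 closL ('X^(p ^ n) - x%:P).
- by rewrite size_XnsubC ?ltnS expn_gt0 prime_gt0.
- exact: separable_XnsubC (pexp_natr_neq0 n) x0.
rewrite /root !hornerE subr_eq0 => /eqP yx; by exists y.
Qed.

Lemma primitive_root_lift n (xi : L) :
  xi ^+ (p ^ n) = iota zeta -> (p ^ n.+1).-primitive_root xi.
Proof.
move=> xiz; have xi1 : xi ^+ (p ^ n.+1) = 1.
  by rewrite expnSr exprM xiz (prim_expr_order root_char_prim).
have pn0 : (0 < p ^ n.+1)%N by rewrite expn_gt0 prime_gt0.
have [m mxi] := prim_order_exists pn0 xi1.
case/(dvdn_pfactor _ _ p_prime) => k; rewrite leq_eqVlt => /orP[/eqP-> <-//|].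
rewrite ltnS => kn mk; have : xi ^+ (p ^ n) = 1.
  by apply/eqP; rewrite -(prim_order_dvd mxi) mk dvdn_exp2l.
rewrite xiz => z1; have := eq_prim_root_expr root_char_prim 0 1.
by rewrite expr0 expr1 z1 eqxx !modn_small ?prime_gt0 ?prime_gt1.
Qed.

(* [b] and [t] record the action on the [p^(n+1)]-th roots of the Kummer
   generator of [chi] and of unity. *)
Lemma affine_action_exists (chi : cochain1 L p) (n : nat) : H1elt iota chi ->
  exists (b t : (L -> L) -> nat) (S : seq L),
  [/\ forall s s', (forall x, x \in S -> s x = s' x) -> b s = b s' /\ t s = t s',
      forall s, inG s -> t s = 1 %[mod p],
      forall s, inG s -> (b s)%:R = chi s,
      forall s s', inG s -> inG s' -> b (s \o s') = b s + t s * b s' %[mod p ^ n.+1]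
    & forall s s', inG s -> inG s' -> t (s \o s') = t s * t s' %[mod p ^ n.+1]].
Proof.
move=> Hchi; have [beta [beta0 bchi]] := eigen_vector_exists Hchi.
have z0 : iota zeta != 0.
  by have := root_char_neq0 1; rewrite -[1]/(1%:R) root_char_nat.
(* [xi] has order [p^(n+1)], and [x^(p^(n+1)) = beta^p] is fixed by G, so every automorphism
   multiplies [x] by a power of [xi]. *)
have [xi xiz] := root_exists n z0.
have [x xb] := root_exists n beta0.
have xi_prim := primitive_root_lift xiz.
set q := (p ^ n.+1)%N in xi_prim *.
have q0 : (0 < q)%N by rewrite expn_gt0 prime_gt0.
have x0 : x != 0.
  by apply: contraNneq beta0 => x0; rewrite -xb x0 expr0n expn_eq0 gtn_eqF ?eqxx ?prime_gt0.
(* The exponent of [xi] that takes [d] to [c], with default 0 when there is none. *)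
pose ex (c d : L) := if [pick i : 'I_q | c == xi ^+ i * d] is Some i then i : nat else 0%N.
have exP c d : d != 0 -> c ^+ q = d ^+ q -> c = xi ^+ (ex c d) * d.
  move=> d0 cd; rewrite /ex; case: pickP => [i /eqP //|no].
  have : (c / d) ^+ q = 1 by rewrite expr_div_n cd divff // expf_neq0.
  by case/(prim_rootP xi_prim) => i e; have := no i; rewrite -e divfK ?eqxx.
pose b s := ex (s x) x; pose t s := ex (s xi) 1.
have tP s : inG s -> s xi = xi ^+ t s.
  move=> Gs; rewrite -[RHS]mulr1; apply: exP; first exact: oner_neq0.
  have [f fs] := inG_rmorphism Gs; rewrite -fs -rmorphXn.
  by rewrite (prim_expr_order xi_prim) rmorph1 expr1n.
have bP s : inG s -> s x = xi ^+ b s * x.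
  move=> Gs; apply: exP => //.
  have [f fs] := inG_rmorphism Gs; rewrite -fs -rmorphXn /q expnSr.
  by rewrite exprM xb rmorphXn /= fs bchi // exprMn root_char_exp mul1r.
exists b, t, [:: x; xi]; split.
- move=> s s' ss'; rewrite /b /t ss' ?ss' // !inE eqxx ?orbT //.
- move=> s Gs; apply/eqP; rewrite -(eq_prim_root_expr root_char_prim) expr1.
  have [f fs] := inG_rmorphism Gs; have [_ _ _ _ sF] := Gs.
  by rewrite -{2}sF -xiz -fs rmorphXn /= fs tP // exprAC.
- move=> s Gs; apply: root_char_inj; apply: (mulIf beta0); rewrite -bchi //.
  have [f fs] := inG_rmorphism Gs; rewrite -xb -fs rmorphXn /= fs bP // exprMn.
  by rewrite root_char_nat -xiz exprAC.
- move=> s s' Gs Gs'; apply/eqP; rewrite -(eq_prim_root_expr xi_prim).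
  apply/eqP/(mulIf x0); rewrite -bP; last exact: inG_comp.
  have [f fs] := inG_rmorphism Gs.
  rewrite /= bP // -fs rmorphM rmorphXn /= !fs tP // bP //.
  by rewrite exprD exprM mulrCA mulrA.
- move=> s s' Gs Gs'; apply/eqP; rewrite -(eq_prim_root_expr xi_prim).
  rewrite -tP; last exact: inG_comp.
  have [f fs] := inG_rmorphism Gs.
  by rewrite /= tP // -fs rmorphXn /= !fs tP // exprM.
Qed.

Hypothesis p_odd : odd p.

(* A full defining system, including the entry [(1, n+1)]: a homomorphism to
   the unipotent group with superdiagonal [chi], up to sign. *)
Definition unipotent_system (n : nat) (chi : nat -> cochain1 L p)
    (u : nat -> nat -> cochain1 L p) : Prop :=
  [/\ forall i j, (1 <= i)%N -> (i < j <= n.+1)%N -> continuous1 iota (u i j),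
      forall i, (1 <= i <= n)%N -> forall s, inG s -> u i i.+1 s = chi i s
    & forall i j, (1 <= i)%N -> (i < j <= n.+1)%N ->
        forall s t, inG s -> inG t ->
          cobound1 (u i j) s t = \sum_(i.+1 <= l < j) u i l s * u l j t].

Lemma sum_nat_reflect (N i j : nat) (G : nat -> 'F_p) : (j <= N)%N ->
  \sum_(i.+1 <= l < j) G (N - l)%N = \sum_((N - j).+1 <= l < N - i) G l.
Proof.
move=> jN; rewrite -[i.+1]add0n big_addn -[(N - j).+1]add0n big_addn.
have -> : (N - i - (N - j).+1 = j - i.+1)%N by lia.
rewrite [RHS]big_nat_rev /= !big_nat; apply: eq_bigr => l lb.
by congr G; lia.
Qed.

Lemma constant_system_exists n (chi : cochain1 L p) : H1elt iota chi ->
  exists u, unipotent_system n (fun=> chi) u.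
Proof.
move=> Hchi.
have [b [t [S [bt_dep t1 bchi bM tM]]]] := affine_action_exists n Hchi.
pose M s a c := affine_coef 'F_p (b s) (t s) a c.
(* The reflection of indices undoes the reversed order of the matrix product. The sign absorbs the
   minus sign of [c (s \o t)] in the coboundary and is trivial for [j = i + 1]. *)
exists (fun i j s => - ((-1) ^+ (j - i) * M s (n.+1 - j)%N (n.+1 - i)%N)); split.
- move=> i j _ _ s Gs; exists S => s' Gs' ss'.
  by have [bb tt] := bt_dep _ _ ss'; rewrite /M bb tt.
- move=> i /andP[i1 ile] s Gs; rewrite subSnn expr1 mulN1r opprK subSS subSn // /M.
  have [_ ->] := affine_coef_unip p_prime p_odd (b s) (n - i) (t1 s Gs).
  exact: bchi.
- move=> i j i1 /andP[ij jn] s s' Gs Gs'.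
  set a := (n.+1 - j)%N; set c := (n.+1 - i)%N.
  have ac : (a < c)%N by rewrite /a /c; lia.
  (* All indices are at most [n < p^(n+1)], so the entries depend only on the affine map modulo
     [p^(n+1)]. *)
  have cq : (c < p ^ n.+1)%N.
    by apply: leq_trans (ltn_expl _ (prime_gt1 p_prime)); rewrite /c; lia.
  rewrite /cobound1 /= -/a -/c.
  have -> : M (s \o s') a c = M s a c + M s' a c + \sum_(a.+1 <= l < c) M s' a l * M s l c.
    rewrite {1}/M (affine_coef_mod p_prime a (bM s s' Gs Gs') (tM s s' Gs Gs') cq).
    rewrite affine_coef_comp ?(ltnW ac) // big_ltn ?ltnS ?(ltnW ac) //.
    rewrite big_nat_recr //= -!/(M _ _ _) addrA.
    have [Maa _] := affine_coef_unip p_prime p_odd (b s') a (t1 s' Gs').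
    have [Mcc _] := affine_coef_unip p_prime p_odd (b s) c (t1 s Gs).
    by rewrite /M Maa Mcc mul1r mulr1 addrAC.
  rewrite -(sum_nat_reflect _ (fun l => M s' a l * M s l c) jn).
  rewrite -/a -/c.
  transitivity ((-1) ^+ (j - i) * \sum_(i.+1 <= l < j) M s' a (n.+1 - l)%N * M s (n.+1 - l)%N c).
    set y := (-1) ^+ (j - i); set w := \sum_(_ <= _ < _) _.
    by rewrite !mulrDr; ring.
  rewrite mulr_sumr !big_nat; apply: eq_bigr => l /andP[il lj].
  rewrite -/a -/c mulrNN; have -> : (j - i = (l - i) + (j - l))%N by lia.
  by rewrite exprD; ring.
Qed.

(** * Assembly from proportional characters *)

Definition proportional (chi alpha : cochain1 L p) : Prop :=
  exists2 c : 'F_p, c != 0 & forall s, inG s -> alpha s = c * chi s.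

Lemma H1elt_proportional (chi alpha : cochain1 L p) :
  proportional chi alpha -> H1elt iota alpha -> H1elt iota chi.
Proof.
move=> [c c0 ac] [contA addA]; split.
  move=> s Gs; have [S SP] := contA s Gs; exists S => t Gt st.
  by apply: (mulfI c0); rewrite -!ac // SP.
move=> s t Gs Gt; apply: (mulfI c0); rewrite mulr0 -(addA s t Gs Gt) /cobound1 /=.
by rewrite !ac //; [ring|exact: inG_comp].
Qed.

(* A common representative for the classes of each maximal run of consecutive
   proportional cochains. *)
Fixpoint line_rep (alpha : nat -> cochain1 L p) (l : nat) : cochain1 L p :=
  if l is k.+1 then
    if `[< proportional (line_rep alpha k) (alpha l) >] then line_rep alpha k
    else alpha l
  else alpha 0.

Lemma line_repP alpha l : proportional (line_rep alpha l) (alpha l).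
Proof.
have refl chi : proportional chi chi.
  by exists 1 => [|s _]; rewrite ?oner_neq0 ?mul1r.
by case: l => [|l] /=; [exact: refl|case: asboolP].
Qed.

(** Entry [(i, j)] of the constant system is scaled by the product of [c l] over [i <= l < j], which
    is multiplicative under concatenation. A zero scalar kills every entry across it; along a
    nonzero entry [chi] is constant. *)
Lemma scaled_system_exists n (chi : nat -> cochain1 L p) (c : nat -> 'F_p) :
  (forall i, (1 <= i <= n)%N -> H1elt iota (chi i)) ->
  (forall i, (1 <= i < n)%N -> c i != 0 -> c i.+1 != 0 -> chi i.+1 = chi i) ->
  exists u, unipotent_system n (fun i s => c i * chi i s) u.
Proof.
move=> Hchi chi_step.
(* Choosing the system as a function of the cochain makes equal characters share the same system. *)
have /choice[U UP] : forall x : cochain1 L p, exists u,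
    H1elt iota x -> unipotent_system n (fun=> x) u.
  move=> x; have [Hx|nHx] := EM (H1elt iota x); last by exists (fun _ _ => x).
  by have [u uP] := constant_system_exists n Hx; exists u.
pose C i j := \prod_(i <= l < j) c l.
have C_cat i l j : (i <= l)%N -> (l <= j)%N -> C i j = C i l * C l j.
  by move=> il lj; rewrite /C (big_cat_nat (n := l)).
have chi_const i l j : (1 <= i)%N -> (i <= l < j)%N -> (j <= n.+1)%N ->
    C i j != 0 -> chi l = chi i.
  move=> i1 /andP[il lj] jn C0; elim: l il lj => [|l IHl].
    by rewrite leqn0 => /eqP ->.
  rewrite leq_eqVlt => /orP[/eqP -> //|il] lj.
  have c_neq0 k : (i <= k < j)%N -> c k != 0.
    case/andP=> ik kj; apply: contraNneq C0 => ck.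
    by rewrite (C_cat _ _ _ ik (ltnW kj)) /C (big_ltn kj) ck mul0r mulr0.
  rewrite -IHl //; last exact: ltnW.
  by apply: chi_step; first lia; apply: c_neq0; lia.
exists (fun i j s => C i j * U (chi i) i j s); split.
- move=> i j i1 /andP[ij jn] s Gs.
  have [contU _ _] := UP _ (Hchi i ltac:(lia)).
  have [|S SP] := contU i j i1 _ s Gs; first by rewrite ij.
  by exists S => t Gt st; rewrite SP.
- move=> i ib s Gs; have [_ supU _] := UP _ (Hchi i ib).
  by rewrite supU // /C big_nat1.
- move=> i j i1 /andP[ij jn] s t Gs Gt.
  have [_ _ cobU] := UP _ (Hchi i ltac:(lia)).
  have := cobU i j i1 _ s t Gs Gt; rewrite ij => /(_ jn) e.
  transitivity (C i j * cobound1 (U (chi i) i j) s t).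
    by rewrite /cobound1; ring.
  rewrite e mulr_sumr !big_nat; apply: eq_bigr => l /andP[il lj].
  have Cij : C i j = C i l * C l j by apply: C_cat; lia.
  have [C0|C0] := eqVneq (C i j) 0.
    by rewrite mulrACA -Cij C0 !mul0r.
  rewrite (chi_const i l j) // ?(ltnW il) ?lj //.
  by rewrite Cij; ring.
Qed.

(** The corner entry [u 1 n.+1] is a cochain whose coboundary is the Massey value. *)
Lemma unipotent_system_contains0 n alpha u :
  (0 < n)%N -> unipotent_system n alpha u -> massey_contains0 iota n alpha.
Proof.
move=> n0 [contu supu cobu]; exists u; split.
  by split=> [i j i1 ij _||i j i1 /andP[ij jn] _]; [exact: contu|exact: supu|];
     apply: cobu; rewrite ?(ltnW ij).
exists (u 1 n.+1); split; first by apply: contu; rewrite ?ltnS ?n0 /=.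
by move=> s t Gs Gt; rewrite cobu // ltnS n0 /=.
Qed.

(** The coboundary of [a i i.+2] is the cup product; [n >= 3] ensures that [(i, i.+2)] is not the
    omitted corner. *)
Lemma defining_system_cup0 n alpha a i : (3 <= n)%N -> (1 <= i < n)%N ->
  defining_system iota n alpha a ->
  H2zero iota (cup11 (alpha i : cochain1 L p) (alpha i.+1)).
Proof.
move=> n3 /andP[i1 ilt] [conta supa coba].
have ne : (i, i.+2) <> (1%N, n.+1) by case=> -> [n2]; rewrite -n2 in n3.
exists (a i i.+2); split; first by apply: conta; rewrite ?ltnS //; lia.
move=> s t Gs Gt; rewrite coba ?ltnS //; try lia.
by rewrite big_nat1 /cup11 !supa //; lia.
Qed.

Lemma massey_vanishing n (alpha : nat -> cochain1 L p) :
  (3 <= n)%N -> p_rigid iota p zeta ->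
  (forall i, (1 <= i <= n)%N -> H1elt iota (alpha i)) ->
  massey_defined iota n alpha -> massey_contains0 iota n alpha.
Proof.
move=> n3 rigid Halpha [a defa].
pose chi := line_rep alpha.
(* The scalar is set to 0 when [alpha l] vanishes on G, so that [c l != 0] provides the nonzero
   class that rigidity requires. *)
have /choice[c cP] : forall l, exists c : 'F_p,
    (forall s, inG s -> alpha l s = c * chi l s) /\
    (c != 0 -> exists s, inG s /\ alpha l s != 0).
  move=> l; have [nz|z0] := EM (exists s, inG s /\ alpha l s != 0).
    by have [c c0 ac] := line_repP alpha l; exists c.
  exists 0; rewrite eqxx; split=> // s Gs; rewrite mul0r.
  by apply: contrapT => /eqP nz; apply: z0; exists s.
have [||u [contu supu cobu]] := @scaled_system_exists n chi c.
- by move=> i /Halpha; apply: H1elt_proportional; apply: line_repP.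
(* By rigidity [alpha i.+1] is a nonzero multiple of [alpha i], hence of [chi i], so [line_rep]
   keeps its representative. *)
- move=> i ib ci ci1; rewrite /chi /=; case: asboolP => // - [].
  have [nzi nzi1] := (proj2 (cP i) ci, proj2 (cP i.+1) ci1).
  have [||k ak] := rigid_proportional rigid _ _ nzi (defining_system_cup0 n3 ib defa).
  + by apply: Halpha; lia.
  + by apply: Halpha; lia.
  have k0 : k != 0.
    have [s [Gs]] := nzi1; apply: contraNneq => k0.
    by rewrite ak // k0 mul0r.
  exists (k * c i) => [|s Gs]; first by rewrite mulf_neq0.
  by rewrite ak // (proj1 (cP i)) // mulrA.
apply: (@unipotent_system_contains0 n alpha u); [lia|split]=> // i ib s Gs.
by rewrite supu // -(proj1 (cP i)).
Qed.

End Kummer.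

Theorem theorem8p5 (n p : nat) (F L : fieldType) (iota : {rmorphism F -> L})
    (zeta : F) :
  (3 <= n)%N -> prime p -> odd p ->
  is_sep_closure iota ->
  (p.-primitive_root zeta)%R ->
  p_rigid iota p zeta ->
  forall alpha : nat -> cochain1 L p,
    (forall i, (1 <= i <= n)%N -> H1elt iota (alpha i)) ->
    massey_defined iota n alpha -> massey_contains0 iota n alpha.
Proof.
move=> n3 p_prime p_odd closL zeta_prim rigid alpha Halpha defined.
exact: (massey_vanishing closL p_prime zeta_prim p_odd n3 rigid Halpha defined).
Qed.
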